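(* Let $p\ge 5$ be a prime number and let $r\ge 1$ be an integer. Let $\mathscr{G}_2(\mathbb{Z}/p^r\mathbb{Z})$ be the graph with vertex set $\mathrm{SL}_2(\mathbb{Z}/p^r\mathbb{Z})$ in which two matrices $x,y$ form an edge if and only if $\det(x+y)=0$ in $\mathbb{Z}/p^r\mathbb{Z}$. Then $$\frac{\sqrt{p}}{4}\ \le\ \chi\big(\mathscr{G}_2(\mathbb{Z}/p^r\mathbb{Z})\big)\ \le\ 8(p+1).$$
   Context: $\chi$ denotes the chromatic number of a graph. *)

(* Defs.v *)
From HB Require Import structures.
From mathcomp Require Import all_boot all_order all_algebra.

Set Implicit Arguments.
Unset Strict Implicit.
Unset Printing Implicit Defensive.

Import GRing.Theory.
Local Open Scope ring_scope.

Record sgraph := SGraph {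
  vertex : finType;
  edge : rel vertex;
  edge_sym : symmetric edge;
  edge_irrefl : irreflexive edge
}.

Definition proper_coloring (G : sgraph) k (f : {ffun vertex G -> 'I_k}) :=
  [forall x, forall y, edge x y ==> (f x != f y)].

Definition colorable (G : sgraph) k :=
  [exists f : {ffun vertex G -> 'I_k}, proper_coloring f].

Lemma colorable_card (G : sgraph) : exists k, colorable G k.
Proof.
exists #|vertex G|; apply/existsP; exists [ffun x => enum_rank x].
apply/forallP => x; apply/forallP => y; apply/implyP => xy; rewrite !ffunE.
by apply: contraTneq xy => /enum_rank_inj ->; rewrite edge_irrefl.
Qed.

Definition chromatic_number (G : sgraph) : nat := ex_minn (colorable_card G).

Definition SL2 (A : finComNzRingType) := {x : 'M[A]_2 | \det x == 1}.

Section DetGraph.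
Variable A : finComNzRingType.

(* The clause [x != y] discards loops, so that the graph is simple over every
   ring [A]; it is redundant as soon as 4 <> 0 in [A], by [det_add_self]. *)
Definition det_edge : rel (SL2 A) :=
  [rel x y | (x != y) && (\det (val x + val y) == 0)].

Lemma det_edge_sym : symmetric det_edge.
Proof. by move=> x y; rewrite /det_edge /= eq_sym addrC. Qed.

Lemma det_edge_irrefl : irreflexive det_edge.
Proof. by move=> x; rewrite /det_edge /= eqxx. Qed.

Definition det_graph : sgraph := SGraph det_edge_sym det_edge_irrefl.

Lemma det_add_self (x : SL2 A) : \det (val x + val x) = 4.
Proof.
by rewrite -mulr2n -scaler_nat detZ (eqP (valP x)) mulr1 -natrX.
Qed.

End DetGraph.

(* Main.v *)
(* Upper bound: reduction mod p is a graph homomorphism, so take r = 1.  If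
   y is adjacent to x and its first column is k times that of x, then
   k det (x + y) = (k + 1)^2 forces k = -1; so the line spanned by the first
   column, together with a sign separating opposite vectors, is a proper
   colouring with 2 (p + 1) colours.

   Lower bound: put A = Z/p^r.  The matrices whose upper left entry is a unit
   are parametrised by the (b, a, c) in A^3 with a a unit, in such a way that x
   and y are adjacent iff v - flip w is isotropic for the form q = a^2 + b c,
   where flip (b, a, c) = (b, -a, c).  The directions (1, m, -m^2) are isotropic
   and any three of them, for m distinct mod p, form a basis of A^3.  Hence, if
   S is independent, no line in such a direction meets both S and flip S; thus
   the averages over these lines of 1_S - 1_(flip S) and of 1_S + 1_(flip S)
   have the same absolute value.  The averaging operators for the p directions
   are commuting projections whose triple products vanish on functions of sum
   zero, so their sum is bounded by 2 there; this gives p |S| <= |A|^3, and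
   summing over the colour classes gives p - 1 <= chi. *)
From HB Require Import structures.
Require Import Defs.
From mathcomp Require Import all_boot all_order all_algebra.
From mathcomp Require Import ring lra.

Import Order.TTheory GRing.Theory Num.Theory.
Local Open Scope ring_scope.

Set Implicit Arguments.
Unset Strict Implicit.
Unset Printing Implicit Defensive.

(** * Inner products of functions on a finite set *)

Section Dot.
Variables (R : realFieldType) (V : finType).
Implicit Types f g h : {ffun V -> R}.

Definition dot f g := \sum_v f v * g v.

Lemma dotC f g : dot f g = dot g f.
Proof. by apply: eq_bigr => v _; rewrite mulrC. Qed.

Lemma dotDl f g h : dot (f + g) h = dot f h + dot g h.
Proof. by rewrite -big_split; apply: eq_bigr => v _; rewrite ffunE mulrDl. Qed.

Lemma dotNl f h : dot (- f) h = - dot f h.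
Proof. by rewrite -sumrN; apply: eq_bigr => v _; rewrite ffunE mulNr. Qed.

Lemma dotDr f g h : dot h (f + g) = dot h f + dot h g.
Proof. by rewrite dotC dotDl !(dotC h). Qed.

Lemma dotNr f h : dot h (- f) = - dot h f.
Proof. by rewrite dotC dotNl dotC. Qed.

Lemma dot_suml I (r : seq I) (P : pred I) (F : I -> {ffun V -> R}) h :
  dot (\sum_(i <- r | P i) F i) h = \sum_(i <- r | P i) dot (F i) h.
Proof.
rewrite exchange_big /=; apply: eq_bigr => v _.
by rewrite sum_ffunE mulr_suml.
Qed.

Lemma dot_sumr I (r : seq I) (P : pred I) (F : I -> {ffun V -> R}) h :
  dot h (\sum_(i <- r | P i) F i) = \sum_(i <- r | P i) dot h (F i).
Proof. by rewrite dotC dot_suml; apply: eq_bigr => i _; rewrite dotC. Qed.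

Lemma dot_ge0 f : 0 <= dot f f.
Proof. by apply: sumr_ge0 => v _; rewrite -expr2 sqr_ge0. Qed.

(** Cauchy-Schwarz against the constant 1, read off from the squared norm of [f] minus its mean. *)
Lemma sum_sqr_le_dot f : (\sum_v f v) ^+ 2 <= #|V|%:R * dot f f.
Proof.
set s := \sum_v f v; set n : R := #|V|%:R.
have [n0|n0] := eqVneq n 0.
  rewrite n0 mul0r /s big1 ?expr0n // => v _.
  by move/eqP: n0; rewrite pnatr_eq0 => /eqP/card0_eq/(_ v).
have n_gt0 : 0 < n by rewrite lt_def n0 ler0n.
have := dot_ge0 (f - [ffun=> s / n]).
have dc g : dot g [ffun=> s / n] = (\sum_v g v) * (s / n).
  by rewrite /dot; under eq_bigr do rewrite ffunE; rewrite -mulr_suml.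
rewrite !(dotDl, dotDr, dotNl, dotNr) (dotC _ f) !dc -/s.
have -> : \sum_(v : V) [ffun=> s / n] v = s.
  rewrite (eq_bigr (fun=> s / n)) => [|v _]; last by rewrite ffunE.
  by rewrite sumr_const -mulr_natr -/n divfK.
move=> /(mulr_ge0 (ltW n_gt0)) h; rewrite -subr_ge0; apply: le_trans h _.
by rewrite le_eqVlt; apply/orP; left; apply/eqP; field.
Qed.

(* For commuting orthogonal projections [P i] all of whose triple products kill
   [f], with [a i = P i f] and [b i j = P i (P j f)].  Bessel's inequality for
   the orthogonal family [b i j], [j != i], gives [|sum_j a j|^2 <= 2 X], where
   [X] is the left-hand side; then expand [|f - (sum_j a j) / 2|^2 >= 0]. *)
Lemma sum_proj_le (I : finType) f (a : I -> {ffun V -> R})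
    (b : I -> I -> {ffun V -> R}) :
    (forall i, dot f (a i) = dot (a i) (a i)) ->
    (forall i j, dot (a i) (b i j) = dot (a i) (a j)) ->
    (forall i j, dot (b i j) (b i j) = dot (a i) (a j)) ->
    (forall i j k, i != j -> i != k -> j != k -> dot (b i j) (b i k) = 0) ->
  \sum_i dot (a i) (a i) <= 2 * dot f f.
Proof.
move=> fa ab bb b0; set X := \sum_i _.
have bessel i : \sum_(j | j != i) dot (a i) (a j) <= dot (a i) (a i).
  have := dot_ge0 (a i - \sum_(j | j != i) b i j).
  rewrite !(dotDl, dotDr, dotNl, dotNr) opprK.
  rewrite (dotC _ (a i)) dot_sumr (eq_bigr _ (fun j _ => ab i j)).
  have -> : dot (\sum_(j | j != i) b i j) (\sum_(j | j != i) b i j)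
            = \sum_(j | j != i) dot (a i) (a j).
    rewrite dot_suml; apply: eq_bigr => j ji.
    rewrite dot_sumr (bigD1 j) //= bb big1 ?addr0 // => k /andP[ki kj].
    by rewrite b0 1?eq_sym // eq_sym.
  by lra.
have aa : dot (\sum_i a i) (\sum_i a i) <= 2 * X.
  rewrite dot_suml mulr_sumr; apply: ler_sum => i _.
  by rewrite dot_sumr (bigD1 i) //= mulrDl mul1r lerD2l bessel.
have fX : dot f (\sum_i a i) = X by rewrite dot_sumr; apply: eq_bigr.
have := dot_ge0 (f + f - \sum_i a i).
rewrite !(dotDl, dotDr, dotNl, dotNr) !(dotC _ f) fX.
by move: aa; lra.
Qed.

End Dot.

(** * Averaging operators along images of homomorphisms *)

Section Averages.
Variables (R : realFieldType) (T V : finZmodType).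
Implicit Types (f g : {ffun V -> R}) (phi psi chi : {additive T -> V}).

Definition avg phi f : {ffun V -> R} :=
  [ffun v => #|T|%:R^-1 * \sum_t f (v + phi t)].

Let cT : R := #|T|%:R.
Let cT0 : cT != 0.
Proof. by rewrite pnatr_eq0 -lt0n; apply/card_gt0P; exists 0. Qed.

Lemma avgD phi f g : avg phi (f + g) = avg phi f + avg phi g.
Proof.
apply/ffunP => v; rewrite !ffunE -mulrDr -big_split; congr (_ * _).
by apply: eq_bigr => t _; rewrite ffunE.
Qed.

Lemma avgN phi f : avg phi (- f) = - avg phi f.
Proof.
apply/ffunP => v; rewrite !ffunE -mulrN -sumrN; congr (_ * _).
by apply: eq_bigr => t _; rewrite ffunE.
Qed.

Lemma sum_avg phi f : \sum_v avg phi f v = \sum_v f v.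
Proof.
under eq_bigr do rewrite ffunE.
rewrite -mulr_sumr exchange_big /=.
rewrite (eq_bigr (fun=> \sum_v f v)) => [|t _]; last first.
  by rewrite [RHS](reindex_inj (addIr (phi t))).
by rewrite sumr_const -[X in _ * X]mulr_natl mulKf.
Qed.

(** The image of [phi] is stable under negation: substitute [- t] for [t], then translate [v]. *)
Lemma avg_adj phi f g : dot (avg phi f) g = dot f (avg phi g).
Proof.
rewrite /dot.
under eq_bigr do rewrite ffunE -mulrA mulr_suml.
under [RHS]eq_bigr do rewrite ffunE mulrCA mulr_sumr.
rewrite -!mulr_sumr; congr (_ * _).
rewrite exchange_big [RHS]exchange_big /= [RHS](reindex_inj oppr_inj) /=.
apply: eq_bigr => t _; rewrite [RHS](reindex_inj (addIr (phi t))) /=.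
by apply: eq_bigr => v _; rewrite raddfN addrK.
Qed.

Lemma avg_id phi f : avg phi (avg phi f) = avg phi f.
Proof.
apply/ffunP => v; rewrite !ffunE; congr (_ * _).
under eq_bigr do rewrite ffunE.
rewrite -mulr_sumr (eq_bigr (fun=> \sum_t f (v + phi t))) => [|t _].
  by rewrite sumr_const -[X in _ * X]mulr_natl mulKf.
rewrite [RHS](reindex_inj (addrI t)) /=.
by apply: eq_bigr => s _; rewrite raddfD addrA.
Qed.

Lemma avgC phi psi f : avg phi (avg psi f) = avg psi (avg phi f).
Proof.
apply/ffunP => v; rewrite !ffunE; congr (_ * _).
under eq_bigr do rewrite ffunE.
under [RHS]eq_bigr do rewrite ffunE.
rewrite -!mulr_sumr exchange_big; congr (_ * _).
by apply: eq_bigr => t _; apply: eq_bigr => s _; rewrite addrAC.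
Qed.

(** By injectivity and cardinality the triple sums of translates of [v] run once over [V], so the
    triple average is the mean of [f]. *)
Lemma avg3_eq0 phi psi chi f :
    #|V| = (#|T| * #|T| * #|T|)%N ->
    (forall t s u, phi t + psi s + chi u = 0 -> [/\ t = 0, s = 0 & u = 0]) ->
  \sum_v f v = 0 -> avg phi (avg psi (avg chi f)) = 0.
Proof.
move=> cV inj f0; apply/ffunP => v; rewrite !ffunE.
pose F (x : T * T * T) := v + (phi x.1.1 + psi x.1.2 + chi x.2).
have Finj : injective F.
  move=> [[t s] u] [[t' s'] u'] /addrI /= /eqP; rewrite -subr_eq0.
  rewrite !opprD addrACA (addrACA (phi t)) -!raddfB.
  by case/eqP/inj => /subr0_eq -> /subr0_eq -> /subr0_eq ->.
have Fbij : bijective F by apply: inj_card_bij => //; rewrite !card_prod cV.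
have sumF : \sum_t \sum_s \sum_u f (F (t, s, u)) = 0.
  rewrite pair_big pair_big -[RHS]f0 [RHS](reindex F) /=; last exact: onW_bij.
  by apply: eq_bigr => -[[t s] u] _.
transitivity (#|T|%:R^-1 * (#|T|%:R^-1 * (#|T|%:R^-1 *
    \sum_t \sum_s \sum_u f (F (t, s, u)))) : R); last by rewrite sumF !mulr0.
congr (_ * _); rewrite !mulr_sumr; apply: eq_bigr => t _; rewrite ffunE.
congr (_ * _); rewrite mulr_sumr; apply: eq_bigr => s _; rewrite ffunE.
by congr (_ * _); apply: eq_bigr => u _; rewrite /F /= !addrA.
Qed.

Lemma sum_avg_le (I : finType) (phi : I -> {additive T -> V}) f :
    #|V| = (#|T| * #|T| * #|T|)%N ->
    (forall i j k, i != j -> i != k -> j != k -> forall t s u,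
       phi i t + phi j s + phi k u = 0 -> [/\ t = 0, s = 0 & u = 0]) ->
    \sum_v f v = 0 ->
  \sum_i dot (avg (phi i) f) (avg (phi i) f) <= 2 * dot f f.
Proof.
move=> cV inj f0.
apply: (sum_proj_le (b := fun i j => avg (phi i) (avg (phi j) f))).
- by move=> i; rewrite avg_adj avg_id.
- by move=> i j; rewrite -avg_adj avg_id.
- by move=> i j; rewrite avg_adj avg_id avgC avg_adj avg_id dotC avg_adj dotC -avg_adj.
- move=> i j k ij ik jk.
  rewrite avg_adj avg_id avg_adj avgC (avg3_eq0 cV (inj _ _ _ ij ik jk) f0).
  by rewrite /dot big1 // => v _; rewrite ffunE mulr0.
Qed.

End Averages.

(** * Isotropic directions in [A3] and sets free of isotropic differences *)

HB.instance Definition _ (U V : finZmodType) := GRing.Zmodule.on (U * V)%type.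

Section LightCone.
Variable A : finComUnitRingType.
Local Notation A3 := (A * A * A)%type.
Implicit Types (v w : A3) (S : {set A3}).

Definition light_dir (m t : A) : A3 := (t, t * m, - (t * m ^+ 2)).

Fact light_dir_is_additive m : zmod_morphism (light_dir m).
Proof. by move=> s t; congr (_, _, _) => /=; ring. Qed.

HB.instance Definition _ m :=
  GRing.isZmodMorphism.Build A A3 (light_dir m) (light_dir_is_additive m).

Local Notation light_avg m := (@avg rat A A3 (light_dir m)).

Definition flip v : A3 := (v.1.1, - v.1.2, v.2).

Lemma flipK : involutive flip.
Proof. by move=> [[b a] c]; rewrite /flip /= opprK. Qed.

Definition qform v := v.1.2 ^+ 2 + v.1.1 * v.2.

Lemma qform_light m t : qform (light_dir m t) = 0.
Proof. by rewrite /qform /=; ring. Qed.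

(** A Vandermonde system: weighting the coordinates by the coefficients of [(x - m1) * (x - m2)]
    isolates [u]; then [s] and [t] follow. *)
Lemma light_dir_inj3 m1 m2 m3 t s u :
    m2 - m1 \is a GRing.unit -> m3 - m1 \is a GRing.unit ->
    m3 - m2 \is a GRing.unit ->
    light_dir m1 t + light_dir m2 s + light_dir m3 u = 0 ->
  [/\ t = 0, s = 0 & u = 0].
Proof.
move=> u21 u31 u32 [e0 e1 e2].
have u0 : u = 0.
  apply/(mulIr u32)/(mulIr u31); rewrite !mul0r.
  have -> : u * (m3 - m2) * (m3 - m1) =
      - (- (t * m1 ^+ 2) + - (s * m2 ^+ 2) + - (u * m3 ^+ 2))
      - (m1 + m2) * (t * m1 + s * m2 + u * m3) + m1 * m2 * (t + s + u) by ring.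
  by rewrite e0 e1 e2; ring.
have s0 : s = 0.
  apply: (mulIr u21); rewrite mul0r.
  have -> : s * (m2 - m1) = (t * m1 + s * m2 + u * m3) - m1 * (t + s + u)
      - u * (m3 - m1) by ring.
  by rewrite e0 e1 u0; ring.
by split=> //; rewrite -e0 s0 u0 !addr0.
Qed.

Lemma light_free_card (I : finType) (m : I -> A) S :
    (forall i j, i != j -> m i - m j \is a GRing.unit) ->
    {in S &, forall v w, qform (v - flip w) != 0} ->
  (#|I| * #|S| <= #|A| * #|A| * #|A|)%N.
Proof.
move=> um freeS; rewrite -!card_prod.
pose f : {ffun A3 -> rat} := [ffun v => (v \in S)%:R].
pose f' : {ffun A3 -> rat} := [ffun v => (flip v \in S)%:R].
have sumf : \sum_v f v = #|S|%:R.
  rewrite -sum1_card natr_sum [RHS]big_mkcond; apply: eq_bigr => v _ /=.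
  by rewrite ffunE; case: (v \in S).
have sumf' : \sum_v f' v = #|S|%:R.
  rewrite -sumf (reindex_inj (inv_inj flipK)) /=.
  by apply: eq_bigr => v _; rewrite !ffunE flipK.
have avgff' i v : light_avg (m i) f v * light_avg (m i) f' v = 0.
  rewrite !ffunE.
  have [/existsP[t tS]|/existsPn nS] := boolP [exists t, v + light_dir (m i) t \in S].
    rewrite [X in _ * (_ * X)]big1 ?mulr0 // => s _; rewrite ffunE.
    case: (boolP (flip _ \in S)) => // sS.
    have := freeS _ _ tS sS; rewrite flipK opprD addrACA subrr add0r -raddfB.
    by rewrite qform_light eqxx.
  rewrite [X in _ * X * _]big1 ?mulr0 ?mul0r // => t _.
  by rewrite ffunE (negPf (nS t)).
(* The end of the proof cancels [4 * #|S|]. *)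
have [->|S0] := posnP #|S|; first by rewrite muln0.
have sum_g : \sum_v (f - f') v = 0.
  rewrite (eq_bigr (fun v => f v - f' v)) => [|v _]; last by rewrite !ffunE.
  by rewrite sumrB sumf sumf' subrr.
have dot_g : dot (f - f') (f - f') <= 2 * #|S|%:R.
  rewrite mulrDl mul1r -{1}sumf -sumf' -big_split; apply: ler_sum => v _ /=.
  rewrite !ffunE; by case: (_ \in _); case: (_ \in _).
have sum_h : \sum_v (f + f') v = 2 * #|S|%:R.
  under eq_bigr do rewrite ffunE.
  by rewrite big_split /= sumf sumf' mulrDl mul1r.
(* Cauchy-Schwarz for the average of [f + f'], whose square agrees pointwise with that of [f - f']
   by [avgff']. *)
have le_i i : (2 * #|S|%:R) ^+ 2 <=
    #|{: A3}|%:R * dot (light_avg (m i) (f - f')) (light_avg (m i) (f - f')).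
  rewrite -sum_h -(@sum_avg _ A A3 (light_dir (m i))).
  apply: le_trans (sum_sqr_le_dot _) _; rewrite le_eqVlt; apply/orP; left.
  apply/eqP; congr (_ * _); apply: eq_bigr => v _.
  move: (avgff' i v); rewrite !avgD avgN; move: (avg _ f) (avg _ f') => F F'.
  rewrite !ffunE; move: (F v) (F' v) => x y xy0.
  transitivity ((x - y) * (x - y) + 4 * (x * y)); first by ring.
  by rewrite xy0 mulr0 addr0.
have := @sum_avg_le _ A A3 _ (fun i => light_dir (m i)) _ _ _ sum_g.
rewrite !card_prod => /(_ erefl) le_g; rewrite -!card_prod.
have {}le_g : \sum_i dot (light_avg (m i) (f - f')) (light_avg (m i) (f - f'))
    <= 2 * dot (f - f') (f - f').
  apply: le_g => i j k ij ik jk t s u; apply: light_dir_inj3; apply: um.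
  - by rewrite eq_sym.
  - by rewrite eq_sym.
  - by rewrite eq_sym.
have S0' : (0 : rat) < #|S|%:R by rewrite ltr0n.
have : \sum_(i : I) (2 * #|S|%:R) ^+ 2 <= #|{: A3}|%:R * (2 * (2 * #|S|%:R)) :> rat.
  apply: le_trans (ler_sum _ (fun i _ => le_i i)) _.
  by rewrite -mulr_sumr ler_wpM2l // (le_trans le_g) // ler_wpM2l.
rewrite sumr_const -[_ *+ #|_|]mulr_natl.
have -> : (2 * #|S|%:R) ^+ 2 = (4 * #|S|%:R) * #|S|%:R :> rat by ring.
have -> : #|{: A3}|%:R * (2 * (2 * #|S|%:R)) = (4 * #|S|%:R) * #|{: A3}|%:R :> rat by ring.
rewrite mulrCA ler_pM2l ?mulr_gt0 //.
by rewrite -natrM ler_nat.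
Qed.
End LightCone.

(** * Determinants of size 2, and colourings by arbitrary finite types *)

Lemma det2E (A : comNzRingType) (M : 'M[A]_2) :
  \det M = M 0 0 * M 1 1 - M 0 1 * M 1 0.
Proof.
rewrite (expand_det_row _ 0) !big_ord_recl big_ord0 /cofactor !det_mx11 !mxE.
rewrite /= addr0 mul1r mulN1r mulrN.
by congr (M _ _ * M _ _ - M _ _ * M _ _); apply/val_inj.
Qed.

Lemma chromatic_number_le_card (G : sgraph) (T : finType)
    (f : vertex G -> T) :
  (forall x y, edge x y -> f x != f y) -> (chromatic_number G <= #|T|)%N.
Proof.
move=> fP; rewrite /chromatic_number; case: ex_minnP => k _; apply.
apply/existsP; exists [ffun x => enum_rank (f x)].
apply/forallP=> x; apply/forallP=> y; apply/implyP=> /fP.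
by rewrite !ffunE (inj_eq enum_rank_inj).
Qed.

Lemma chromatic_number_coloring (G : sgraph) :
  exists f : vertex G -> 'I_(chromatic_number G),
    forall x y, edge x y -> f x != f y.
Proof.
rewrite /chromatic_number; case: ex_minnP => k /existsP[f /forallP fP] _.
by exists f => x y; have /forallP/(_ y)/implyP := fP x.
Qed.

(** * Lower bound, through a chart of SL2 *)

Section LowerBound.
Variable A : finComUnitRingType.
Local Notation A3 := (A * A * A)%type.
Implicit Types v w : A3.

(** Scaling [b] and [c] by [a^-1] is what makes the determinant of a sum a unit multiple of [qform]
    at a difference. *)
Definition chart_mx v : 'M[A]_2 :=
  let: (b, a, c) := v in
  \matrix_(i, j) if i == 0 then if j == 0 then a^-1 else a^-1 * b
                 else if j == 0 then a^-1 * c else a + a^-1 * b * c.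

Lemma det_chart v : v.1.2 \is a GRing.unit -> \det (chart_mx v) = 1.
Proof.
case: v => [[b a] c] /= ua; rewrite det2E !mxE /= -(mulVr ua); ring.
Qed.

Lemma det_chartD v w : v.1.2 \is a GRing.unit -> w.1.2 \is a GRing.unit ->
  \det (chart_mx v + chart_mx w) = v.1.2^-1 * w.1.2^-1 * qform (v - flip w).
Proof.
case: v w => [[b a] c] [[b' a'] c'] /= ua ua'; rewrite det2E !mxE /qform /=.
rewrite opprK.
transitivity (a^-1 * a + a'^-1 * a' + a^-1 * a' + a'^-1 * a
    + a^-1 * a'^-1 * (b - b') * (c - c')); first by ring.
(* [ring] does not relate [a^-1] to [a]: factors equal to 1 are inserted so that every term contains
   [a^-1 * a'^-1]. *)
transitivity ((a^-1 * a) * (a'^-1 * a) + (a'^-1 * a') * (a^-1 * a')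
  + (a^-1 * a) * (a'^-1 * a') *+ 2 + a^-1 * a'^-1 * (b - b') * (c - c')).
  by rewrite !mulVr //; ring.
by ring.
Qed.

Lemma card_mul_unit_le (I : finType) (m : I -> A) :
    (forall i j, i != j -> m i - m j \is a GRing.unit) -> 4 != 0 :> A ->
  (#|I| * #|[set a : A | a \is a GRing.unit]|
     <= chromatic_number (det_graph A) * #|A|)%N.
Proof.
move=> um nz4; have [f fP] := chromatic_number_coloring (det_graph A).
set k := chromatic_number _ in f fP *; set U := [set a : A | _].
have det1 : \det (1%:M : 'M[A]_2) == 1 by rewrite det1.
(* The identity matrix is a default value, never taken on [D]. *)
pose chart v : SL2 A := insubd (Sub 1%:M det1 : SL2 A) (chart_mx v).
have chartE v : v.1.2 \is a GRing.unit -> val (chart v) = chart_mx v.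
  by move=> uv; rewrite val_insubd det_chart // eqxx.
pose D := [set v : A3 | v.1.2 \in U].
pose S i := [set v in D | f (chart v) == i].
have cD : #|D| = (#|A| * #|U| * #|A|)%N.
  have -> : D = setX (setX setT U) setT.
    by apply/setP => -[[b a] c]; rewrite !inE /= andbT.
  by rewrite !cardsX !cardsT.
have cS : #|D| = (\sum_i #|S i|)%N.
  rewrite -sum1_card (partition_big (fun v => f (chart v)) predT) //=.
  by apply: eq_bigr => i _; rewrite -sum1_card; apply: eq_bigl => v; rewrite !inE.
have leS i : (#|I| * #|S i| <= #|A| * #|A| * #|A|)%N.
  apply: (light_free_card um) => v w; rewrite !inE.
  move=> /andP[uv /eqP cv] /andP[uw /eqP cw]; apply/eqP => q0.
  have det0 : \det (val (chart v) + val (chart w)) = 0.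
    by rewrite !chartE // det_chartD // q0 mulr0.
  have /negP[] : ~~ (f (chart v) != f (chart w)) by rewrite cv cw negbK.
  apply: fP; rewrite /edge /= /det_edge /= det0 eqxx andbT.
  (* Were the two matrices equal, their sum would have determinant 4. *)
  apply: contra nz4 => /eqP vw.
  by rewrite -(det_add_self (chart w)) -[X in X + _](congr1 val vw) det0.
have A0 : (0 < #|A| * #|A|)%N by rewrite muln_gt0 andbb; apply/card_gt0P; exists 0.
rewrite -(leq_pmul2r A0).
have -> : (#|I| * #|U| * (#|A| * #|A|) = #|I| * #|D|)%N.
  by rewrite cD -!mulnA; congr (_ * _)%N; rewrite mulnCA.
rewrite cS big_distrr /=.
apply: (@leq_trans (\sum_(i < k) #|A| * #|A| * #|A|)%N).
  by apply: leq_sum => i _.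
by rewrite sum_nat_const card_ord -!mulnA.
Qed.

End LowerBound.

(** Colourings pull back along [h] applied entrywise; [4 != 0] in [B] keeps the images of adjacent
    matrices distinct. *)
Lemma chromatic_number_det_graph_morph (A B : finComNzRingType)
    (h : {rmorphism A -> B}) : 4 != 0 :> B ->
  (chromatic_number (det_graph A) <= chromatic_number (det_graph B))%N.
Proof.
move=> nz4; have [f fP] := chromatic_number_coloring (det_graph B).
have detP (x : SL2 A) : \det (map_mx h (val x)) == 1.
  by rewrite det_map_mx (eqP (valP x)) rmorph1.
pose hx x : SL2 B := Sub (map_mx h (val x)) (detP x).
rewrite -[X in (_ <= X)%N]card_ord.
apply: (chromatic_number_le_card (f := fun x : vertex (det_graph A) => f (hx x))).
move=> x y /andP[_ /eqP det0]; apply: fP; rewrite /edge /= /det_edge /=.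
have det0' : \det (val (hx x) + val (hx y)) = 0.
  by rewrite /= -map_mxD det_map_mx det0 rmorph0.
rewrite [X in _ && X](_ : _ = true) ?andbT; last by apply/eqP.
apply: contra nz4 => /eqP xy.
by rewrite -(det_add_self (hx y)) -[X in X + _](congr1 val xy) det0'.
Qed.

(** * Upper bound over a finite field *)

Section UpperBound.
Variable F : finFieldType.

(** A point of the projective line, with [None] for the direction of [(1, 0)]. *)
Definition line_of (u : F * F) : option F :=
  if u.2 == 0 then None else Some (u.1 / u.2).

(** Stands in for a sign: it selects one element of each pair of distinct [a], [- a]. *)
Definition half_sign (a : F) : bool := (enum_rank a < enum_rank (- a))%N.

Definition vec_sign (u : F * F) : bool :=
  half_sign (if u.2 == 0 then u.1 else u.2).

Lemma half_signN a : a != - a -> half_sign (- a) = ~~ half_sign a.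
Proof.
move=> aN; rewrite /half_sign opprK -leqNgt ltn_neqAle.
suff -> : val (enum_rank (- a)) != val (enum_rank a) by [].
by rewrite (inj_eq val_inj) (inj_eq enum_rank_inj) eq_sym.
Qed.

Lemma line_ofP (u w : F * F) : u != 0 -> w != 0 -> line_of u = line_of w ->
  exists2 k, k != 0 & w = (k * u.1, k * u.2).
Proof.
case: u w => [u1 u2] [w1 w2]; rewrite /line_of /=.
have [->|u20] := eqVneq u2 0; have [->|w20] := eqVneq w2 0 => //.
  rewrite !xpair_eqE !eqxx !andbT => u0 w0 _; exists (w1 / u1).
    by rewrite mulf_neq0 ?invr_eq0.
  by rewrite mulr0 divfK.
move=> _ _ [e]; exists (w2 / u2); first by rewrite mulf_neq0 ?invr_eq0.
by rewrite divfK // mulrAC -mulrA e mulrCA divff // mulr1.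
Qed.

Lemma chromatic_number_det_graph_le : 2 != 0 :> F ->
  (chromatic_number (det_graph F) <= 2 * (#|F| + 1))%N.
Proof.
move=> nz2.
have aN (a : F) : a != 0 -> a != - a.
  by move=> a0; rewrite -addr_eq0 -mulr2n -mulr_natl mulf_neq0.
pose col (x : SL2 F) : F * F := (val x 0 0, val x 1 0).
have col0 x : col x != 0.
  apply/eqP => -[e0 e1]; have := eqP (valP x).
  by rewrite det2E e0 e1 mul0r mulr0 subr0 => /eqP; rewrite eq_sym oner_eq0.
have -> : (2 * (#|F| + 1) = #|{: bool * option F}|)%N.
  by rewrite card_prod card_option card_bool addn1.
pose f (x : vertex (det_graph F)) := (vec_sign (col x), line_of (col x)).
apply: (chromatic_number_le_card (f := f)) => x y /andP[_ /eqP].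
rewrite det2E !mxE => det0; apply/eqP => -[sxy /(line_ofP (col0 _) (col0 _))].
move=> [k k0 yE]; have [y0 y1] := yE.
have dx := eqP (valP x); have dy := eqP (valP y).
rewrite !det2E ?y0 ?y1 in dx dy det0.
have kN1 : k = -1.
  apply/eqP; rewrite -addr_eq0; suff: (k + 1) ^+ 2 == 0 by rewrite expf_eq0.
  apply/eqP; transitivity (k * 0 : F); last by rewrite mulr0.
  (* Since the first column of [y] is [k] times that of [x], [k * det (x + y) = (1 + k) * (k * det x
     + det y)]. *)
  transitivity ((1 + k) * (k * (val x 0 0 * val x 1 1 - val x 0 1 * val x 1 0)
      + (k * val x 0 0 * val y 1 1 - val y 0 1 * (k * val x 1 0)))).
    by rewrite dx dy; ring.
  by rewrite -det0; ring.
move: sxy; rewrite yE kN1; move: (col x) (col0 x) => [a b].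
rewrite xpair_eqE /vec_sign /= !mulN1r oppr_eq0.
have [_|b0 _] := eqVneq b 0; last by rewrite half_signN ?aN //; case: half_sign.
by rewrite andbT => a0; rewrite half_signN ?aN //; case: half_sign.
Qed.

End UpperBound.

(** * Reduction from Z/q to the prime field *)

Section Reduction.
Variables (p q : nat).
Hypotheses (p_prime : prime p) (q_gt1 : (1 < q)%N) (p_dv_q : (p %| q)%N).

(* The unused proofs are arguments so that the morphism structures below, which
   depend on them, can be inferred. *)
Definition Zp_to_Fp of prime p & (1 < q)%N & (p %| q)%N :=
  fun x : 'Z_q => (x : nat)%:R : 'F_p.

Local Notation red := (Zp_to_Fp p_prime q_gt1 p_dv_q).

(** As [p] divides [q], a prior reduction mod [q] is harmless. The morphism laws follow, since
    natural numbers exhaust ['Z_q]. *)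
Lemma red_nat n : red n%:R = n%:R.
Proof.
rewrite /Zp_to_Fp val_Zp_nat // -[RHS](Fp_nat_mod p_prime) -(modn_dvdm n p_dv_q).
by rewrite Fp_nat_mod.
Qed.

Fact red_is_zmod_morphism : zmod_morphism red.
Proof.
have redD : {morph red : x y / x + y}.
  by move=> x y; rewrite -[x]natr_Zp -[y]natr_Zp -natrD !red_nat natrD.
move=> x y; apply/eqP; rewrite eq_sym subr_eq; apply/eqP.
by rewrite -redD subrK.
Qed.

Fact red_is_monoid_morphism : monoid_morphism red.
Proof.
split; first exact: (red_nat 1).
by move=> x y; rewrite -[x]natr_Zp -[y]natr_Zp -natrM !red_nat natrM.
Qed.

HB.instance Definition _ :=
  GRing.isZmodMorphism.Build 'Z_q 'F_p red red_is_zmod_morphism.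
HB.instance Definition _ :=
  GRing.isMonoidMorphism.Build 'Z_q 'F_p red red_is_monoid_morphism.

End Reduction.

Theorem theorem1p11 (R : rcfType) (p r : nat) (hp : prime p)
    (hp5 : (5 <= p)%N) (hr : (1 <= r)%N) :
  Num.sqrt p%:R / 4 <= (chromatic_number (det_graph 'Z_(p ^ r)))%:R :> R
    /\ (chromatic_number (det_graph 'Z_(p ^ r)) <= 8 * (p + 1))%N.
Proof.
have q_gt1 : (1 < p ^ r)%N by rewrite -[1%N](exp1n r) ltn_exp2r // prime_gt1.
have cpq n : coprime (p ^ r) n = ~~ (p %| n)%N.
  by rewrite coprime_pexpl // prime_coprime.
have pNdvd n : (0 < n < p)%N -> ~~ (p %| n)%N.
  by case/andP=> n0 np; rewrite gtnNdvd.
have nzF n : (0 < n < p)%N -> n%:R != 0 :> 'F_p.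
  by move=> /pNdvd; rewrite -(dvdn_pcharf (pchar_Fp hp)).
have cZ : #|'Z_(p ^ r)| = (p ^ r)%N by rewrite card_ord Zp_cast.
split; last first.
  apply: leq_trans (chromatic_number_det_graph_morph
    (Zp_to_Fp hp q_gt1 (dvdn_exp hr (dvdnn p)) : {rmorphism _ -> _}) _) _.
    by apply: (nzF 4).
  apply: leq_trans (chromatic_number_det_graph_le _) _.
    by apply: (nzF 2); rewrite (leq_trans _ hp5).
  by rewrite card_Fp // leq_mul2r orbT.
(* Distinct integers in [[0, p)] differ by an integer prime to [p], so they supply [p]
   directions. *)
have um (i j : 'I_p) : i != j ->
    i%:R - j%:R \is a @GRing.unit 'Z_(p ^ r).
  wlog ltij : i j / (j < i)%N.
    move=> wl ij; have [ji|ij'|/val_inj e] := ltngtP j i.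
    - exact: wl.
    - by rewrite -opprB unitrN wl // eq_sym.
    - by rewrite e eqxx in ij.
  move=> _; rewrite -natrB ?(ltnW ltij) // unitZpE // cpq pNdvd //.
  by rewrite subn_gt0 ltij (leq_ltn_trans (leq_subr _ _)).
have nz4 : 4 != 0 :> 'Z_(p ^ r).
  have : (4%:R : 'Z_(p ^ r)) \is a GRing.unit by rewrite unitZpE // cpq pNdvd.
  by apply: contraTneq => ->; rewrite unitr0.
have := card_mul_unit_le um nz4.
have -> : #|[set a : 'Z_(p ^ r) | a \is a GRing.unit]| = (p.-1 * p ^ r.-1)%N.
  rewrite -totient_pfactor // -card_units_Zp ?expn_gt0 ?prime_gt0 //.
  by rewrite cardsT card_sub cardsE; apply: eq_card => a.
(* Here [p * ((p - 1) * p ^ (r - 1)) = (p - 1) * p ^ r], and [p ^ r] cancels. *)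
rewrite cZ card_ord mulnCA -expnS prednK // leq_pmul2r; last exact: ltnW.
move=> le_chi.
apply: (@le_trans _ _ (p.-1)%:R); last by rewrite ler_nat.
have p5 : 5 <= p%:R :> R by rewrite (ler_nat _ 5).
have -> : (p.-1)%:R = p%:R - 1 :> R by rewrite -subn1 natrB // (leq_trans _ hp5).
have sqrt_le : Num.sqrt p%:R <= p%:R :> R.
  have := sqrtr_ge0 (p%:R : R); have := sqr_sqrtr (ler0n R p).
  by nra.
by lra.
Qed.
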